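(* Let $n\geq 3$. There exist two convex bodies $K,L\subset\mathbb{R}^n$ such that $K\neq L$ and $K\neq -L$, but nevertheless for every $\xi\in S^{n-1}$ there is an orthogonal transformation $\phi_\xi\in O(n-1)$ in $\xi^\perp$ satisfying $\phi_\xi(K\cap\xi^\perp)=L\cap\xi^\perp$.
   Context: A convex body in $\mathbb{R}^n$ is a compact set with non-empty interior such that the segment joining every pair of its points is contained in it. $S^{n-1}$ is the unit sphere of $\mathbb{R}^n$, and for $\xi\in S^{n-1}$, $\xi^\perp=\{x\in\mathbb{R}^n:\langle x,\xi\rangle=0\}$ is the hyperplane through the origin perpendicular to $\xi$. ''$\phi_\xi\in O(n-1)$ in $\xi^\perp$'' means that $\phi_\xi$ is a linear orthogonal transformation of the $(n-1)$-dimensional Euclidean space $\xi^\perp$ onto itself. $-L=\{-x:x\in L\}$. *)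

(* Defs.v *)
From mathcomp Require Import all_boot all_order all_algebra.
From mathcomp Require Import all_classical all_reals all_analysis.

Set Implicit Arguments.
Unset Strict Implicit.
Unset Printing Implicit Defensive.

Import Order.TTheory GRing.Theory Num.Theory.
Import numFieldNormedType.Exports.

Local Open Scope classical_set_scope.
Local Open Scope ring_scope.

Section Definitions.
Variables (R : realType) (n : nat).
Implicit Types (x y xi : 'rV[R]_n) (A K : set 'rV[R]_n).

Definition inner x y : R := \sum_(i < n) x 0 i * y 0 i.

(* The library norm `|x| on row vectors is the sup norm; it induces the
   Euclidean topology but not the Euclidean sphere. *)
Definition enorm x : R := Num.sqrt (inner x x).

Definition unit_sphere : set 'rV[R]_n := [set x | enorm x = 1].

Definition perp xi : set 'rV[R]_n := [set x | inner x xi = 0].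

Definition convex_body K : Prop :=
  [/\ compact K, interior K !=set0 & convex_set K].

Definition reflect_set A : set 'rV[R]_n := [set - x | x in A].

(* The map is total on R^n, but only its restriction to [perp xi] matters. *)
Definition orthogonal_transf xi (phi : 'rV[R]_n -> 'rV[R]_n) : Prop :=
  [/\ forall (a : R) x y, perp xi x -> perp xi y ->
        phi (a *: x + y) = a *: phi x + phi y,
      phi @` perp xi = perp xi &
      forall x y, perp xi x -> perp xi y ->
        inner (phi x) (phi y) = inner x y].

End Definitions.

Arguments unit_sphere {R n}.

(* Main.v *)
(** Fix orthonormal a, b and let q(x) = <x,a>^2 - <x,b>^2 = <x,a-b><x,a+b>.
    Each body is the unit ball with two caps shaved off, by ellipsoids
    2|x|^2 + q(x) = 2 and 2|x|^2 - q(x) = 2: K is shaved around a and around b,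
    L around a and around -b. On a hyperplane xi^perp, let p and m be the
    projections of a-b and a+b; the reflection of xi^perp swapping the
    directions of p and m preserves the norm and q, it keeps the sign of <x,a>
    where q > 0 and reverses that of <x,b> where q < 0. Hence it maps the section
    of K onto the section of L. If p = 0, m = 0 or p and m have the same
    direction, then q >= 0 on xi^perp, the cap around b or -b is not met, and the
    identity works. *)

Require Import Defs.
From mathcomp Require Import all_boot all_order all_algebra.
From mathcomp Require Import all_classical all_reals all_analysis.
From mathcomp Require Import ring lra.
Import Order.TTheory GRing.Theory Num.Theory.
Import numFieldNormedType.Exports.
Local Open Scope classical_set_scope.
Local Open Scope ring_scope.

(** * The Euclidean inner product: bilinearity, positivity, continuity *)

Lemma innerC {R : realType} {n : nat} (x y : 'rV[R]_n) : inner x y = inner y x.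
Proof. by apply: eq_bigr => i _; rewrite mulrC. Qed.

Lemma innerDl {R : realType} {n : nat} (x y z : 'rV[R]_n) :
  inner (x + y) z = inner x z + inner y z.
Proof. by rewrite -big_split; apply: eq_bigr => i _; rewrite mxE mulrDl. Qed.

Lemma innerZl {R : realType} {n : nat} (k : R) (x z : 'rV[R]_n) :
  inner (k *: x) z = k * inner x z.
Proof. by rewrite /inner mulr_sumr; apply: eq_bigr => i _; rewrite mxE mulrA. Qed.

Lemma innerDr {R : realType} {n : nat} (x y z : 'rV[R]_n) :
  inner z (x + y) = inner z x + inner z y.
Proof. by rewrite innerC innerDl !(innerC z). Qed.

Lemma innerZr {R : realType} {n : nat} (k : R) (x z : 'rV[R]_n) :
  inner z (k *: x) = k * inner z x.
Proof. by rewrite innerC innerZl innerC. Qed.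

Lemma innerNl {R : realType} {n : nat} (x z : 'rV[R]_n) :
  inner (- x) z = - inner x z.
Proof. by rewrite -scaleN1r innerZl mulN1r. Qed.

Lemma innerNr {R : realType} {n : nat} (x z : 'rV[R]_n) :
  inner z (- x) = - inner z x.
Proof. by rewrite innerC innerNl innerC. Qed.

Lemma inner0r {R : realType} {n : nat} (x : 'rV[R]_n) : inner x 0 = 0.
Proof. by rewrite -(scale0r 0) innerZr mul0r. Qed.

Definition innerE {R : realType} {n : nat} :=
  (@innerDl R n, @innerDr R n, @innerNl R n, @innerNr R n,
   @innerZl R n, @innerZr R n).

Lemma inner_ge0 {R : realType} {n : nat} (x : 'rV[R]_n) : 0 <= inner x x.
Proof. by apply: sumr_ge0 => i _; rewrite -expr2 sqr_ge0. Qed.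

Lemma inner_eq0 {R : realType} {n : nat} (x : 'rV[R]_n) :
  inner x x = 0 -> x = 0.
Proof.
move=> /eqP; rewrite psumr_eq0 => [/allP x0|i _]; last by rewrite -expr2 sqr_ge0.
apply/rowP => i; rewrite mxE; apply/eqP.
by have := x0 i (mem_index_enum _); rewrite mulf_eq0 orbb.
Qed.

Lemma inner_delta {R : realType} {n : nat} (x : 'rV[R]_n) (i : 'I_n) :
  inner x (delta_mx 0 i) = x 0 i.
Proof.
rewrite /inner (bigD1 i) //= mxE !eqxx mulr1 big1 ?addr0 // => j ji.
by rewrite mxE (negbTE ji) andbF mulr0.
Qed.

Lemma inner_delta_self {R : realType} {n : nat} (i : 'I_n) :
  inner (delta_mx 0 i) (delta_mx 0 i) = 1 :> R.
Proof. by rewrite inner_delta mxE !eqxx. Qed.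

(** The difference of the two sides is the squared norm of the component of [x] orthogonal to
    [u]. *)
Lemma bessel {R : realType} {n : nat} (u x : 'rV[R]_n) :
  inner u u = 1 -> inner x u ^+ 2 <= inner x x.
Proof.
move=> u1; have := inner_ge0 (x - inner x u *: u).
by rewrite !innerE u1 (innerC u x); set c := inner x u; nra.
Qed.

Lemma inner_continuousl {R : realType} {n : nat} (u : 'rV[R]_n) :
  continuous (fun x : 'rV[R]_n => inner x u).
Proof.
apply: continuous_big => [|i _ x]; first exact: add_continuous.
by apply: continuousM; [exact: (@coord_continuous R 1 n 0 i)|exact: cst_continuous].
Qed.

Lemma inner_self_continuous {R : realType} {n : nat} :
  continuous (fun x : 'rV[R]_n => inner x x).
Proof.
apply: continuous_big => [|i _ x]; first exact: add_continuous.
by apply: continuousM; exact: (@coord_continuous R 1 n 0 i).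
Qed.

(** * The saddle form and clipped balls as convex bodies *)

Definition saddle {R : realType} {n : nat} (a b x : 'rV[R]_n) : R :=
  inner x a ^+ 2 - inner x b ^+ 2.

Lemma saddleC {R : realType} {n : nat} (a b x : 'rV[R]_n) :
  saddle b a x = - saddle a b x.
Proof. by rewrite /saddle opprB. Qed.

Lemma saddleNl {R : realType} {n : nat} (a b x : 'rV[R]_n) :
  saddle (- a) b x = saddle a b x.
Proof. by rewrite /saddle innerNr sqrrN. Qed.

Lemma saddleNr {R : realType} {n : nat} (a b x : 'rV[R]_n) :
  saddle a (- b) x = saddle a b x.
Proof. by rewrite /saddle innerNr sqrrN. Qed.

Lemma saddle_factor {R : realType} {n : nat} (a b x : 'rV[R]_n) :
  saddle a b x = inner x (a - b) * inner x (a + b).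
Proof. by rewrite /saddle !innerE; ring. Qed.

(* The unit ball, with an ellipsoid cutting off a cap around [a] only; the
   ellipsoid leaves the ball alone where [saddle a b <= 0], in particular on the
   hyperplane orthogonal to [a], which is why the result is still convex. *)
Definition clipped_ball {R : realType} {n : nat} (a b : 'rV[R]_n)
    : set 'rV[R]_n :=
  [set x | inner x x <= 1 /\
           (0 < inner x a -> 2 * inner x x + saddle a b x <= 2)].

Lemma clipped_ballNr {R : realType} {n : nat} (a b : 'rV[R]_n) :
  clipped_ball a (- b) = clipped_ball a b.
Proof. by apply/seteqP; split => x; rewrite /clipped_ball /= saddleNr. Qed.

(** For a quadratic form Q, s Q(x) + (1-s) Q(y) - Q(sx + (1-s)y) = s(1-s) Q(x-y). Taking [e] to be 0
    gives the ball, 1/2 the ellipsoid. *)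
Lemma quadratic_sublevel_convex {R : realType} {n : nat} (a b x y : 'rV[R]_n)
    (e c s : R) :
  (forall z, 0 <= inner z z + e * saddle a b z) -> 0 <= s <= 1 ->
  inner x x + e * saddle a b x <= c -> inner y y + e * saddle a b y <= c ->
  inner (s *: x + (1 - s) *: y) (s *: x + (1 - s) *: y)
    + e * saddle a b (s *: x + (1 - s) *: y) <= c.
Proof.
move=> /(_ (x - y)) Qxy /andP[s0 s1] Qx Qy.
have {}Qxy : 0 <= s * (1 - s) *
    (inner (x - y) (x - y) + e * saddle a b (x - y)).
  by rewrite mulr_ge0 // mulr_ge0 // subr_ge0.
have {}Qx := ler_wpM2l s0 Qx.
have {}Qy : (1 - s) * (inner y y + e * saddle a b y) <= (1 - s) * c.
  by rewrite ler_wpM2l // subr_ge0.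
have := lerD Qx Qy; rewrite (_ : s * c + _ = c); last by ring.
apply: le_trans.
rewrite -subr_ge0; apply: le_trans Qxy _.
rewrite le_eqVlt; apply/orP; left; apply/eqP.
by rewrite /saddle !innerE (innerC y x); ring.
Qed.

Lemma clipped_ball_segment {R : realType} {n : nat} (a b x y : 'rV[R]_n)
    (s : R) :
  inner b b = 1 -> 0 <= s <= 1 ->
  clipped_ball a b x -> clipped_ball a b y ->
  clipped_ball a b (s *: x + (1 - s) *: y).
Proof.
move=> b1.
have ball (u v : 'rV[R]_n) t : 0 <= t <= 1 ->
    inner u u <= 1 -> inner v v <= 1 ->
    inner (t *: u + (1 - t) *: v) (t *: u + (1 - t) *: v) <= 1.
  move=> t01 u1 v1.
  have := @quadratic_sublevel_convex R n a b u v 0 1 t.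
  by rewrite !mul0r !addr0; apply=> // z; rewrite mul0r addr0 inner_ge0.
have ellipsoid (u v : 'rV[R]_n) t : 0 <= t <= 1 ->
    2 * inner u u + saddle a b u <= 2 -> 2 * inner v v + saddle a b v <= 2 ->
    2 * inner (t *: u + (1 - t) *: v) (t *: u + (1 - t) *: v)
      + saddle a b (t *: u + (1 - t) *: v) <= 2.
  move=> t01 Hu Hv.
  have := @quadratic_sublevel_convex R n a b u v 2^-1 1 t.
  have H z : 0 <= inner z z + 2^-1 * saddle a b z.
    have := bessel b z b1; have := sqr_ge0 (inner z a); have := inner_ge0 z.
    by rewrite /saddle; lra.
  by move=> /(_ H t01); lra.
(* Exchanging the endpoints replaces [s] by [1 - s], so [y] may be taken as the endpoint further
   towards [a]. *)
wlog: s x y / inner x a <= inner y a => [wl s01 Kx Ky|xy s01 [x1 xE] [y1 yE]].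
  have [xy|/ltW yx] := leP (inner x a) (inner y a); first exact: wl.
  have -> : s *: x + (1 - s) *: y = (1 - s) *: y + (1 - (1 - s)) *: x.
    by rewrite subKr addrC.
  apply: wl => //.
  by case/andP: s01 => ? ?; apply/andP; split; lra.
split; first exact: ball.
move=> z0; rewrite innerDl !innerZl in z0.
have [s0 s1] := andP s01.
have y0 : 0 < inner y a by nra.
have [x0|x0] := ltP 0 (inner x a).
  by apply: ellipsoid => //; auto.
(* [w] is the point where the segment crosses the hyperplane orthogonal to [a] *)
pose c := inner y a / (inner y a - inner x a).
have d0 : 0 < inner y a - inner x a by lra.
have c0 : 0 < c by rewrite divr_gt0.
have c1 : c <= 1 by rewrite ler_pdivrMr //; lra.
(* The point has positive product with [a], so it lies between [w] and [y]. *)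
have sc : s / c <= 1.
  rewrite ler_pdivrMr // mul1r ler_pdivlMr //; nra.
pose w := c *: x + (1 - c) *: y.
have wa : inner w a = 0.
  by rewrite /w !innerE /c; field; lra.
have w1 : inner w w <= 1 by apply: ball => //; rewrite (ltW c0).
have -> : s *: x + (1 - s) *: y = (s / c) *: w + (1 - s / c) *: y.
  apply/rowP => i; rewrite /w !mxE; field; lra.
(* At [w] the saddle form is [- inner w b ^+ 2], so the ball bound already puts [w] in the
   ellipsoid. *)
apply: ellipsoid; [|by have := sqr_ge0 (inner w b); rewrite /saddle wa; lra|auto].
by rewrite sc divr_ge0 // ltW.
Qed.

Lemma clipped_ball_convex {R : realType} {n : nat} (a b : 'rV[R]_n) :
  inner b b = 1 -> convex_set (clipped_ball a b).
Proof.
move=> b1 x y l /set_mem Kx /set_mem Ky; apply/mem_set.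
apply: (clipped_ball_segment a b x y l%:num) => //.
by apply/andP; split.
Qed.

Lemma clipped_ball_closed {R : realType} {n : nat} (a b : 'rV[R]_n) :
  closed (clipped_ball a b).
Proof.
(* The strict inequality in the premise makes its negation a closed half-space. *)
have -> : clipped_ball a b =
    [set x | inner x x <= 1] `&`
    ([set x | inner x a <= 0] `|` [set x | 2 * inner x x + saddle a b x <= 2]).
  apply/seteqP; split => x [x1 xE]; split => //.
    by have [/xE|] := ltP 0 (inner x a); [right|left].
  by case: xE => /= xE xa //; move: xa; rewrite ltNge xE.
have sublevel (f : 'rV[R]_n -> R) c :
    continuous f -> closed [set x | f x <= c].
  by move=> fc; apply: preimage_closed (@closed_le R c) => x _; exact: fc.
apply: closedI; first exact/sublevel/inner_self_continuous.
apply: closedU; apply: sublevel; first exact: inner_continuousl.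
move=> x.
apply: (@continuousD _ _ _ (fun x => 2 * inner x x) (saddle a b)).
  by apply: continuousM; [exact: cst_continuous|exact: inner_self_continuous].
by apply: continuousB; apply: continuousM; exact: inner_continuousl.
Qed.

Lemma clipped_ball_interior {R : realType} {n : nat} (a b : 'rV[R]_n) :
  inner a a = 1 -> interior (clipped_ball a b) 0.
Proof.
move=> a1.
(* On this ball [saddle a b x <= inner x x], so the ellipsoid's form is at most 3/2. *)
have : open [set x : 'rV[R]_n | inner x x < 2^-1].
  apply: (open_comp _ (@open_lt R 2^-1)) => x _; exact: inner_self_continuous.
move=> oB; apply: filterS (open_nbhs_nbhs (conj oB _)) => /=; last first.
  by rewrite inner0r invr_gt0.
move=> x /= x2; have := bessel a x a1; have := sqr_ge0 (inner x b).
by rewrite /clipped_ball /saddle /=; split; lra.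
Qed.

Lemma clipped_ball2_body {R : realType} {n : nat} (a b c d : 'rV[R]_n) :
  inner a a = 1 -> inner b b = 1 -> inner c c = 1 -> inner d d = 1 ->
  convex_body (clipped_ball a b `&` clipped_ball c d).
Proof.
move=> a1 b1 c1 d1; split.
(* Compactness comes from the cube: Bessel against the standard basis bounds each coordinate by
   1. *)
- apply: (subclosed_compact _ (@rV_compact R n (fun=> `[-1, 1]%classic) _)).
  + by apply: closedI; exact: clipped_ball_closed.
  + by move=> i; exact: segment_compact.
  + move=> x [[x1 _] _] i /=.
    have := bessel (delta_mx 0 i) x (inner_delta_self i).
    by rewrite inner_delta in_itv /= => xi; apply/andP; split; nra.
- by exists 0; rewrite interiorI; split; exact: clipped_ball_interior.
- move=> x y l /set_mem[? ?] /set_mem[? ?]; apply/mem_set.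
  by split; apply/set_mem/clipped_ball_convex => //; exact/mem_set.
Qed.

(** * Householder reflections *)

(* Division by zero being zero, [householder 0] is the identity. *)
Definition householder {R : realType} {n : nat} (w x : 'rV[R]_n) : 'rV[R]_n :=
  x - (2 * inner x w / inner w w) *: w.

Lemma inner_householder {R : realType} {n : nat} (w x y : 'rV[R]_n) :
  inner (householder w x) (householder w y) = inner x y.
Proof.
rewrite /householder; have [w0|w0] := eqVneq (inner w w) 0.
  by rewrite w0 invr0 !mulr0 !scale0r !subr0.
by rewrite !innerE (innerC w y); field.
Qed.

Lemma householderK {R : realType} {n : nat} (w : 'rV[R]_n) :
  involutive (householder w).
Proof.
move=> x; rewrite /householder; have [w0|w0] := eqVneq (inner w w) 0.
  by rewrite w0 invr0 !mulr0 !scale0r !subr0.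
set k := 2 * inner x w / inner w w; rewrite !innerE.
have -> : 2 * (inner x w - k * inner w w) / inner w w = - k.
  by rewrite /k; field.
by rewrite scaleNr opprK subrK.
Qed.

Lemma perp_householder {R : realType} {n : nat} (xi w x : 'rV[R]_n) :
  perp xi w -> perp xi x -> perp xi (householder w x).
Proof. by rewrite /perp /= !innerE => -> ->; rewrite mulr0 subr0. Qed.

Lemma householder_orthogonal {R : realType} {n : nat} (xi w : 'rV[R]_n) :
  perp xi w -> orthogonal_transf xi (householder w).
Proof.
move=> wxi; split.
- move=> k x y _ _; rewrite /householder !innerE.
  by apply/rowP => i; rewrite !mxE; ring.
- apply/seteqP; split => [_ [x xxi <-]|x xxi]; first exact: perp_householder.
  by exists (householder w x); [exact: perp_householder|exact: householderK].
- by move=> x y _ _; exact: inner_householder.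
Qed.

(* [householder w] is the reflection swapping the directions of [p] and [m]. *)
Lemma householder_swap {R : realType} {n : nat} (p m x : 'rV[R]_n) :
  let w := enorm m *: p - enorm p *: m in
  w != 0 ->
  enorm m * inner (householder w x) p = enorm p * inner x m /\
  enorm p * inner (householder w x) m = enorm m * inner x p.
Proof.
move=> w wn0; set s := enorm p; set t := enorm m.
have ss : inner p p = s ^+ 2 by rewrite sqr_sqrtr // inner_ge0.
have tt : inner m m = t ^+ 2 by rewrite sqr_sqrtr // inner_ge0.
have ww : inner w w = 2 * (s * t) * (s * t - inner p m).
  by rewrite /w !innerE -/s -/t ss tt (innerC m p); ring.
have ww0 : inner w w != 0 by apply: contra_neq wn0; exact: inner_eq0.
(* [w] meets the rescaled vectors [t *: p] and [s *: m] in opposite products, so reflecting along it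
   exchanges [t * inner x p] and [s * inner x m]. *)
have wp : t * inner w p = inner w w / 2.
  by rewrite ww /w !innerE -/s -/t ss (innerC m p); field.
have wm : s * inner w m = - (inner w w / 2).
  by rewrite ww /w !innerE -/s -/t tt; field.
have xw : inner x w = t * inner x p - s * inner x m.
  by rewrite /w !innerE.
clearbody w; rewrite /householder !innerDl !innerNl !innerZl.
by split; rewrite mulrBr [_ * (_ * inner w _)]mulrCA ?wp ?wm xw; field.
Qed.

(** * Action of the reflections on the saddle form and the bodies *)

(* The vectors with [saddle a b > 0] (resp. [< 0]) form a double cone around
   [a] (resp. [b]), whose two halves are told apart by the sign of [inner _ a]
   (resp. [inner _ b]): the map keeps the halves of the first and exchanges
   those of the second. *)
Definition saddle_flip {R : realType} {n : nat} (a b x y : 'rV[R]_n) : Prop :=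
  [/\ inner y y = inner x x, saddle a b y = saddle a b x,
      0 < saddle a b x -> Num.sg (inner y a) = Num.sg (inner x a) &
      saddle a b x < 0 -> Num.sg (inner y b) = - Num.sg (inner x b)].

Lemma saddle_flipN {R : realType} {n : nat} (a b x y : 'rV[R]_n) :
  saddle_flip a b x y -> saddle_flip a (- b) x y.
Proof.
move=> [yy qy ya yb]; split; rewrite ?saddleNr // => q0.
by rewrite !innerNr !sgrN yb.
Qed.

(** On the hyperplane the saddle form is the product of [inner x p] and [inner x m], while
    [inner x a] and [inner x b] are half their sum and half their difference. Swapping the two
    factors up to reciprocal positive scalings fixes the product, keeps the sign of the sum when
    they agree in sign, and reverses that of the difference when they do not. *)
Lemma section_flip {R : realType} {n : nat} (a b xi : 'rV[R]_n) :
  unit_sphere xi ->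
  exists2 w, perp xi w &
    forall x, perp xi x -> saddle_flip a b x (householder w x).
Proof.
move=> xi1.
have {}xi1 : inner xi xi = 1.
  by rewrite -[LHS]sqr_sqrtr ?inner_ge0 // -/(enorm xi) xi1 expr1n.
pose proj (u : 'rV[R]_n) := u - inner u xi *: xi.
have projP u : perp xi (proj u).
  by rewrite /perp /proj /= !innerE xi1 mulr1 subrr.
have inner_proj x u : perp xi x -> inner x (proj u) = inner x u.
  by move=> xxi; rewrite /proj !innerE xxi mulr0 subr0.
pose p := proj (a - b); pose m := proj (a + b).
pose s := enorm p; pose t := enorm m.
have s0 : 0 <= s by exact: sqrtr_ge0.
have t0 : 0 <= t by exact: sqrtr_ge0.
have enorm0 (u : 'rV[R]_n) : enorm u = 0 -> u = 0.
  move=> u0; apply: inner_eq0.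
  by rewrite -[LHS]sqr_sqrtr ?inner_ge0 // -/(enorm u) u0 expr0n.
have wxi : perp xi (t *: p - s *: m).
  have [pxi mxi] := (projP (a - b), projP (a + b)).
  by rewrite /perp /= innerDl innerNl !innerZl pxi mxi !mulr0 subr0.
exists (t *: p - s *: m) => // x xxi.
have q_factor y : perp xi y -> saddle a b y = inner y p * inner y m.
  by move=> yxi; rewrite saddle_factor !inner_proj.
have aE y : perp xi y -> 2 * inner y a = inner y p + inner y m.
  by move=> yxi; rewrite !inner_proj // !innerE; ring.
have bE y : perp xi y -> 2 * inner y b = inner y m - inner y p.
  by move=> yxi; rewrite !inner_proj // !innerE; ring.
have [w0|wn0] := eqVneq (t *: p - s *: m) 0.
  have -> : householder (t *: p - s *: m) x = x.
    by rewrite w0 /householder scaler0 subr0.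
  (* The reflection is the identity here, so the sign reversal must be vacuous: the saddle form is
     nonnegative on the hyperplane. *)
  split=> //; rewrite q_factor //; suff : 0 <= inner x p * inner x m by lra.
  have xpm : t * inner x p = s * inner x m.
    by apply/eqP; rewrite -subr_eq0 -!innerZr -innerNr -innerDr w0 inner0r.
  have [sp|sn] := eqVneq s 0.
    by rewrite (enorm0 _ sp) inner0r mul0r.
  have sp : 0 < s by rewrite lt_neqAle eq_sym sn.
  have -> : inner x m = t / s * inner x p.
    by rewrite mulrAC xpm mulrAC divff // mul1r.
  by rewrite mulrCA mulr_ge0 ?divr_ge0 // -expr2 sqr_ge0.
have [yp ym] := householder_swap p m x wn0.
have yxi := perp_householder _ _ _ wxi xxi.
have yy := inner_householder (t *: p - s *: m) x x.
set y := householder _ x in yp ym yxi yy *.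
rewrite -/s -/t in yp ym.
have sp : 0 < s.
  rewrite lt_neqAle eq_sym s0 andbT; apply: contra_neq wn0 => sz.
  by rewrite sz (enorm0 _ sz) scaler0 scale0r subr0.
have tp : 0 < t.
  rewrite lt_neqAle eq_sym t0 andbT; apply: contra_neq wn0 => tz.
  by rewrite tz (enorm0 _ tz) scaler0 scale0r subr0.
clearbody y p m; have {aE}[xa ya] := (aE _ xxi, aE _ yxi).
have {bE}[xb yb] := (bE _ xxi, bE _ yxi).
have {q_factor}[qx qy] := (q_factor _ xxi, q_factor _ yxi).
have yp_gt0 : (0 < inner y p) = (0 < inner x m).
  by rewrite -(pmulr_rgt0 _ tp) yp pmulr_rgt0.
have yp_lt0 : (inner y p < 0) = (inner x m < 0).
  by rewrite -(pmulr_rlt0 _ tp) yp pmulr_rlt0.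
have ym_gt0 : (0 < inner y m) = (0 < inner x p).
  by rewrite -(pmulr_rgt0 _ sp) ym pmulr_rgt0.
have ym_lt0 : (inner y m < 0) = (inner x p < 0).
  by rewrite -(pmulr_rlt0 _ sp) ym pmulr_rlt0.
split; first exact: yy.
- rewrite qx qy; apply: (mulfI (lt0r_neq0 (mulr_gt0 tp sp))).
  by rewrite mulrACA yp ym; ring.
- rewrite qx; have [xp|xp|<-] := ltgtP 0 (inner x p); last by rewrite mul0r ltxx.
  + rewrite pmulr_rgt0 // => xm.
    rewrite xp in ym_gt0; rewrite xm in yp_gt0.
    by rewrite !gtr0_sg //; lra.
  + rewrite nmulr_rgt0 // => xm.
    rewrite xp in ym_lt0; rewrite xm in yp_lt0.
    by rewrite !ltr0_sg //; lra.
- rewrite qx; have [xp|xp|<-] := ltgtP 0 (inner x p); last by rewrite mul0r ltxx.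
  + rewrite pmulr_rlt0 // => xm.
    rewrite xp in ym_gt0; rewrite xm in yp_lt0.
    by rewrite gtr0_sg ?ltr0_sg ?opprK //; lra.
  + rewrite nmulr_rlt0 // => xm.
    rewrite xp in ym_lt0; rewrite xm in yp_gt0.
    by rewrite ltr0_sg ?gtr0_sg //; lra.
Qed.

(** Each ellipsoid constraint bites only where its saddle form is positive; there the flip carries
    the cap of [x] to that of [y]. Elsewhere the ball bound suffices. *)
Lemma clipped_ball_flip {R : realType} {n : nat} (a b x y : 'rV[R]_n) :
  saddle_flip a b x y ->
  (clipped_ball a b `&` clipped_ball b a) x ->
  (clipped_ball a b `&` clipped_ball (- b) a) y.
Proof.
move=> [yy qy ya yb] [[x1 xA] [_ xB]].
rewrite saddleC in xB.
split; split; rewrite ?yy // => y0.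
- rewrite qy; have [q0|q0] := ltP 0 (saddle a b x).
    by apply: xA; rewrite -sgr_gt0 -ya // sgr_gt0.
  by lra.
- rewrite saddleNl saddleC qy; have [q0|q0] := ltP (saddle a b x) 0.
    by apply: xB; rewrite -sgr_gt0 -[Num.sg _]opprK -yb // -sgrN -innerNr sgr_gt0.
  by lra.
Qed.

Theorem theorem1p3 (R : realType) (n : nat) (hn : (3 <= n)%N) :
  exists K L : set 'rV[R]_n,
    [/\ convex_body K, convex_body L, K <> L, K <> reflect_set L &
        forall xi : 'rV[R]_n, unit_sphere xi ->
          exists phi : 'rV[R]_n -> 'rV[R]_n,
            orthogonal_transf xi phi /\
            phi @` (K `&` perp xi) = L `&` perp xi].
Proof.
pose i0 : 'I_n := Ordinal (leq_trans (isT : (0 < 3)%N) hn).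
pose i1 : 'I_n := Ordinal (leq_trans (isT : (1 < 3)%N) hn).
pose a : 'rV[R]_n := delta_mx 0 i0; pose b : 'rV[R]_n := delta_mx 0 i1.
have a1 : inner a a = 1 by exact: inner_delta_self.
have b1 : inner b b = 1 by exact: inner_delta_self.
have ab : inner a b = 0 by rewrite inner_delta mxE.
have ba : inner b a = 0 by rewrite innerC.
have bN1 : inner (- b) (- b) = 1 by rewrite !innerE opprK.
exists (clipped_ball a b `&` clipped_ball b a).
exists (clipped_ball a b `&` clipped_ball (- b) a).
split.
- exact: clipped_ball2_body.
- exact: clipped_ball2_body.
(* The point [b] lies in the second body, shaved around [- b], but is cut off from the first, where
   the ellipsoid's form takes the value 3. *)
- move=> /seteqP[_ /(_ b)]; rewrite /clipped_ball /saddle /=.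
  rewrite !innerNr b1 ba => -[]; first by split; split; lra.
  by move=> _ [_]; lra.
(* Both bodies are shaved around [a] and neither around [- a], so [a] is in the reflected second
   body but not in the first. *)
- move=> /seteqP[_ /(_ a)]; rewrite /reflect_set /clipped_ball /saddle /= => -[].
    exists (- a); last by rewrite opprK.
    by rewrite !innerE a1 ab; split; split; lra.
  by rewrite a1 ab; move=> [_]; lra.
move=> xi /(section_flip a b)[w wxi flip].
exists (householder w); split; first exact: householder_orthogonal.
apply/seteqP; split => [_ [x [Kx xxi] <-]|y [Ly yxi]].
  split; last exact: perp_householder.
  exact: (clipped_ball_flip a b x _ (flip x xxi)).
exists (householder w y); last exact: householderK.
split; last exact: perp_householder.
(* Replacing [b] by [- b] exchanges the two bodies, so the same reflection maps the second section
   back into the first. *)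
have := clipped_ball_flip a (- b) y _ (saddle_flipN a b _ _ (flip y yxi)).
by rewrite opprK clipped_ballNr; exact.
Qed.
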